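(* The Nichols algebra $\mathfrak B(V_{3,1})$ is, as an algebra, the algebra generated by the elements $x=e_1$, $y=e_2$ subject to the relations $$x^2-2y^2=0,\qquad xy+yx=0,\qquad y^4=0.$$ In particular, $\dim\mathfrak B(V_{3,1})=8$.
   Context: $\Bbbk$ is an algebraically closed field of characteristic zero and $\xi\in\Bbbk$ is a fixed primitive $4$-th root of unity. $\mathcal K$ is the $8$-dimensional Hopf algebra over $\Bbbk$ generated as an algebra by $a,b,c,d$ with relations $ab=\xi ba$, $ac=\xi ca$, $cb=bc=0$, $cd=\xi dc$, $bd=\xi db$, $ad=da$, $ad=1$, $b^2=c^2=0$, $a^2c=b$, $a^4=1$, with $\Delta(a)=a\otimes a+b\otimes c$, $\Delta(b)=a\otimes b+b\otimes d$, $\Delta(c)=c\otimes a+d\otimes c$, $\Delta(d)=c\otimes b+d\otimes d$, $\varepsilon(a)=\varepsilon(d)=1$, $\varepsilon(b)=\varepsilon(c)=0$, $\mathcal S(a)=d$, $\mathcal S(b)=\xi b$, $\mathcal S(c)=-\xi c$, $\mathcal S(d)=a$. ${}^{\mathcal K}_{\mathcal K}\mathcal{YD}$ is the category of left Yetter-Drinfeld modules over $\mathcal K$: left modules and left comodules $M$ (coaction $\delta(m)=m_{(-1)}\otimes m_{(0)}$) with $\delta(h\cdot m)=h_{(1)}m_{(-1)}\mathcal S(h_{(3)})\otimes h_{(2)}\cdot m_{(0)}$; its braiding is $c_{M,N}(m\otimes n)=m_{(-1)}\cdot n\otimes m_{(0)}$. The Nichols algebra $\mathfrak B(V)$ is the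 (unique up to isomorphism) $\mathbb N$-graded braided Hopf algebra $R=\bigoplus_{n\ge0}R(n)$ in this category with $R(0)\simeq\Bbbk$, $R(1)\simeq V$, $R(1)$ equal to the space of primitive elements of $R$, and $R$ generated as an algebra by $R(1)$. For $i\in\mathbb Z_4$ and $\lambda=\xi^i$, $V_{i,1}\in{}^{\mathcal K}_{\mathcal K}\mathcal{YD}$ has basis $e_1,e_2$, action $a\cdot e_1=\lambda e_1$, $b\cdot e_1=c\cdot e_1=0$, $d\cdot e_1=\lambda^{-1}e_1$, $a\cdot e_2=-\xi\lambda e_2$, $b\cdot e_2=\lambda^2e_1$, $c\cdot e_2=e_1$, $d\cdot e_2=\xi\lambda^{-1}e_2$, and coaction $\delta(e_1)=d\otimes e_1+(\lambda^3-\xi\lambda)c\otimes e_2$, $\delta(e_2)=a\otimes e_2+\frac12(\lambda+\xi\lambda^3)b\otimes e_1$. Here $i=3$, $\lambda=-\xi$. *)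

(* Defs.v *)
From HB Require Import structures.
From mathcomp Require Import all_boot all_order all_algebra.
From mathcomp Require Import generic_quotient ring_quotient.
From mathcomp Require Import finmap boolp monalg.

Set Implicit Arguments.
Unset Strict Implicit.
Unset Printing Implicit Defensive.

Import GRing.Theory.
Local Open Scope ring_scope.
Local Open Scope quotient_scope.

Reserved Notation "V ⊗ W" (at level 35, right associativity).
Reserved Notation "v ⊠ w" (at level 35, right associativity).
Reserved Notation "\tsum_ ( x , y <- t ) F"
  (at level 41, x name, y name, t at level 100, F at level 41, right associativity,
   format "'[' \tsum_ ( x ,  y  <-  t ) '/  '  F ']'").

(* Tensor product of k-spaces: the free k-module on V * W modulo the           *)
(* bilinearity relations. [tlift f t] is the sum of the f v w over a           *)
(* decomposition of t into pure tensors v ⊠ w; for bilinear f it is the linear *)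
(* map induced by f ([tlift_pure], [tlift_linear]), and \tsum_ is Sweedler     *)
(* notation: \tsum_(x, y <- t) F stands for the sum of the F over t = x ⊠ y.   *)
Section Tensor.
Variables (k : fieldType) (V W : lmodType k).

Local Notation pairs := {malg k[(V * W)%type]}.
Local Notation "<[ v , w ]>" := (<< (v, w) >> : pairs).

Definition tensor_rels : {pred pairs} := fun z => `[< forall S : {pred pairs},
  GRing.submod_closed S ->
  (forall c v v' w, <[c *: v + v', w]> - (c *: <[v, w]> + <[v', w]>) \in S) ->
  (forall c v w w', <[v, c *: w + w']> - (c *: <[v, w]> + <[v, w']>) \in S) ->
  z \in S >].

Fact tensor_rels_submod : GRing.submod_closed tensor_rels.
Proof.
split=> [|c x y].
  by apply/asboolP => S [].
rewrite ![_ \in tensor_rels]unfold_in => /asboolP hx /asboolP hy.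
by apply/asboolP => S Ssub hl hr; apply: (Ssub.2); [apply: hx|apply: hy].
Qed.

HB.instance Definition _ :=
  GRing.isSubmodClosed.Build k pairs tensor_rels tensor_rels_submod.

Definition tensor := Quotient.quot tensor_rels.
HB.instance Definition _ := GRing.Zmodule.on tensor.

Let tpi (z : pairs) : tensor := \pi z.

Fact tpi_eq (x y : pairs) : (tpi x = tpi y) <-> (x - y \in tensor_rels).
Proof. by rewrite Quotient.idealrBE; split=> [/eqP|/eqP]. Qed.

Fact tpiD (x y : pairs) : tpi (x + y) = tpi x + tpi y.
Proof. exact: raddfD. Qed.

Fact tpi_repr (t : tensor) : tpi (repr t) = t.
Proof. exact: reprK. Qed.

Definition tscale (c : k) (t : tensor) : tensor := tpi (c *: repr t).

Fact tscale_tpi c (x : pairs) : tscale c (tpi x) = tpi (c *: x).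
Proof.
apply/tpi_eq; rewrite -scalerBr; apply: rpredZ.
by apply/tpi_eq; rewrite tpi_repr.
Qed.

Fact tscaleA c d t : tscale c (tscale d t) = tscale (c * d) t.
Proof. by rewrite -[t]tpi_repr !tscale_tpi scalerA. Qed.
Fact tscale1 : left_id 1 tscale.
Proof. by move=> t; rewrite /tscale scale1r tpi_repr. Qed.
Fact tscaleDr : right_distributive tscale +%R.
Proof.
move=> c x y; rewrite -[x]tpi_repr -[y]tpi_repr.
by rewrite -tpiD !tscale_tpi scalerDr tpiD.
Qed.
Fact tscaleDl t : {morph tscale^~ t : c d / c + d}.
Proof. by move=> c d; rewrite /= /tscale scalerDl tpiD. Qed.

HB.instance Definition _ := GRing.Zmodule_isLmodule.Build k tensor
  tscaleA tscale1 tscaleDr tscaleDl.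

Fact tscaleE c (t : tensor) : c *: t = tscale c t. Proof. by []. Qed.

Definition tpure (v : V) (w : W) : tensor := tpi <[v, w]>.

Definition tlift (U : lmodType k) (f : V -> W -> U) (t : tensor) : U :=
  \sum_(p <- msupp (repr t)) (repr t)@_p *: f p.1 p.2.

Definition bilinear_map (U : lmodType k) (f : V -> W -> U) : Prop :=
  (forall v, linear (f v)) /\ (forall w, linear (f^~ w)).

Fact tpureDl c v v' w : tpure (c *: v + v') w = c *: tpure v w + tpure v' w.
Proof.
rewrite /tpure tscaleE tscale_tpi -tpiD; apply/tpi_eq.
by apply/asboolP => S _ + _; apply.
Qed.

Fact tpureDr c v w w' : tpure v (c *: w + w') = c *: tpure v w + tpure v w'.
Proof.
rewrite /tpure tscaleE tscale_tpi -tpiD; apply/tpi_eq.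
by apply/asboolP => S _ _; apply.
Qed.

Lemma tpure_bilinear : bilinear_map tpure.
Proof. by split=> v c x y; rewrite ?tpureDl ?tpureDr. Qed.

Section Lift.
Variables (U : lmodType k) (f : V -> W -> U).

Let ev (z : pairs) : U := \sum_(p <- msupp z) z@_p *: f p.1 p.2.

Let evw (d : {fset V * W}) z : (msupp z `<=` d)%fset ->
  ev z = \sum_(p <- d) z@_p *: f p.1 p.2.
Proof.
move=> le; rewrite /ev (big_fset_incl _ le) => //= x xd /mcoeff_outdom ->.
by rewrite scale0r.
Qed.

Let ev_linear : linear ev.
Proof.
move=> c x y; pose d := (msupp x `|` msupp y)%fset.
rewrite (@evw d (c *: x + y)) ?(@evw d x) ?(@evw d y) ?fsubsetUl ?fsubsetUr //.
  rewrite scaler_sumr -big_split; apply: eq_bigr => p _ /=.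
  by rewrite mcoeffD mcoeffZ scalerDl scalerA.
apply/fsubsetP => p; rewrite -mcoeff_neq0 mcoeffD mcoeffZ in_fsetU.
by case: (msuppP x); case: (msuppP y); rewrite // mulr0 addr0 eqxx.
Qed.

Let ev_pure v w : ev <[v, w]> = f v w.
Proof.
rewrite (@evw [fset (v, w)]%fset) ?msuppU_le // big_seq_fset1.
by rewrite mcoeffUU scale1r.
Qed.

Hypothesis fbil : bilinear_map f.

Let ev_rels z : z \in tensor_rels -> ev z = 0.
Proof.
pose ker : {pred pairs} := fun z => ev z == 0.
have evD x y : ev (x + y) = ev x + ev y.
  by rewrite -[x in LHS]scale1r ev_linear scale1r.
have ev0 : ev 0 = 0 by rewrite /ev msupp0 big_seq_fset0.
have evZ c x : ev (c *: x) = c *: ev x by rewrite -[c *: x]addr0 ev_linear ev0 addr0.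
have evB x y : ev (x - y) = ev x - ev y by rewrite -[- y]scaleN1r evD evZ scaleN1r.
move=> /asboolP /(_ ker) h; apply/eqP; apply: h.
- split=> [|c x y]; rewrite !unfold_in /ker ?ev0 ?eqxx // ev_linear.
  by move=> /eqP-> /eqP->; rewrite scaler0 addr0.
- move=> c v v' w; rewrite unfold_in /ker evB evD evZ !ev_pure.
  by rewrite (fbil.2 w) subrr.
- move=> c v w w'; rewrite unfold_in /ker evB evD evZ !ev_pure.
  by rewrite (fbil.1 v) subrr.
Qed.

Let tlift_tpi z : tlift f (tpi z) = ev z.
Proof.
have /ev_rels : repr (tpi z) - z \in tensor_rels by apply/tpi_eq; rewrite tpi_repr.
rewrite addrC -scaleN1r ev_linear scaleN1r addrC => /eqP.
by rewrite subr_eq0 => /eqP.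
Qed.

Lemma tlift_linear : linear (tlift f).
Proof.
move=> c x y; rewrite -[x]tpi_repr -[y]tpi_repr.
by rewrite tscaleE tscale_tpi -tpiD !tlift_tpi ev_linear.
Qed.

Lemma tlift_pure v w : tlift f (tpure v w) = f v w.
Proof. by rewrite /tpure tlift_tpi ev_pure. Qed.

End Lift.

Lemma tensor_span (t : tensor) :
  exists s : seq (V * W), t = \sum_(p <- s) tpure p.1 p.2.
Proof.
rewrite -[t]tpi_repr; set z := repr t; exists [seq (z@_p *: p.1, p.2) | p <- msupp z].
rewrite big_map {1}[z]monalgE /tpi raddf_sum; apply: eq_bigr => -[v w] _ /=.
have -> : << z@_(v, w) *g (v, w) >> = z@_(v, w) *: <[v, w]>.
  by apply/malgP => p; rewrite mcoeffZ !mcoeffU mulr_natr.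
rewrite -/(tpi _) -tscale_tpi -tscaleE.
have := tpureDl (z@_(v, w)) v 0 w.
have tp0 : tpure 0 w = 0.
  by have := tpureDl (-1) 0 0 w; rewrite scaler0 addr0 scaleN1r addNr.
by rewrite addr0 tp0 addr0 => ->.
Qed.

End Tensor.

Notation "V ⊗ W" := (tensor V W) : type_scope.
Notation "v ⊠ w" := (tpure v w) : ring_scope.
Notation "\tsum_ ( x , y <- t ) F" := (tlift (fun x y => F) t) : ring_scope.

(* P ⊗ Q as a subset of V ⊗ W, for subspaces P of V and Q of W. *)
Definition tensor_sub (k : fieldType) (V W : lmodType k)
    (P : {pred V}) (Q : {pred W}) (t : V ⊗ W) : Prop :=
  exists2 s : seq (V * W), all (fun p => (p.1 \in P) && (p.2 \in Q)) s &
    t = \sum_(p <- s) p.1 ⊠ p.2.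

Section HopfAlgebras.
Variable k : fieldType.

Record isCoalgebra (C : lmodType k) (comul : C -> C ⊗ C) (counit : C -> k) : Prop := {
  comul_linear : linear comul;
  counit_scalar : scalar counit;
  comulA : forall x,
    \tsum_(y, x3 <- comul x) \tsum_(x1, x2 <- comul y) x1 ⊠ (x2 ⊠ x3) =
    \tsum_(x1, y <- comul x) x1 ⊠ comul y;
  counitl : forall x, \tsum_(x1, x2 <- comul x) counit x1 *: x2 = x;
  counitr : forall x, \tsum_(x1, x2 <- comul x) counit x2 *: x1 = x
}.

Record isAntipode (A : algType k) (comul : A -> A ⊗ A) (counit : A -> k)
    (S : A -> A) : Prop := {
  antipode_linear : linear S;
  antipodel : forall x, \tsum_(x1, x2 <- comul x) (S x1 * x2) = counit x *: 1;
  antipoder : forall x, \tsum_(x1, x2 <- comul x) (x1 * S x2) = counit x *: 1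
}.

Record hopfAlg := HopfAlg {
  hopf_alg :> algType k;
  hcomul : hopf_alg -> hopf_alg ⊗ hopf_alg;
  hcounit : hopf_alg -> k;
  hanti : hopf_alg -> hopf_alg;
  hopf_coalgebra : isCoalgebra hcomul hcounit;
  hcomul1 : hcomul 1 = 1 ⊠ 1;
  hcomulM : forall x y, hcomul (x * y) =
    \tsum_(x1, x2 <- hcomul x) \tsum_(y1, y2 <- hcomul y) (x1 * y1) ⊠ (x2 * y2);
  hcounit1 : hcounit 1 = 1;
  hcounitM : forall x y, hcounit (x * y) = hcounit x * hcounit y;
  hopf_antipode : isAntipode hcomul hcounit hanti
}.

End HopfAlgebras.

Section YetterDrinfeld.
Variables (k : fieldType) (H : hopfAlg k).

Record ydData := YDData {
  yd_lmod :> lmodType k;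
  act : H -> yd_lmod -> yd_lmod;
  coact : yd_lmod -> H ⊗ yd_lmod
}.

Record isYD (M : ydData) : Prop := {
  act_bilinear : bilinear_map (@act M);
  act1 : forall m : M, act 1 m = m;
  actM : forall (g h : H) (m : M), act (g * h) m = act g (act h m);
  coact_linear : linear (@coact M);
  coactA : forall m : M,
    \tsum_(h, m0 <- coact m) \tsum_(h1, h2 <- hcomul h) h1 ⊠ (h2 ⊠ m0) =
    \tsum_(h, m0 <- coact m) h ⊠ coact m0;
  coact_counit : forall m : M, \tsum_(h, m0 <- coact m) hcounit h *: m0 = m;
  coact_act : forall (h : H) (m : M), coact (act h m) =
    \tsum_(g, h3 <- hcomul h) \tsum_(h1, h2 <- hcomul g)
      \tsum_(m1, m0 <- coact m) (h1 * m1 * hanti h3) ⊠ act h2 m0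
}.

Record ydModule := YDModule { yd_data :> ydData; ydP : isYD yd_data }.

Record isYDHom (M N : ydData) (f : M -> N) : Prop := {
  ydhom_linear : linear f;
  ydhom_act : forall h m, f (act h m) = act h (f m);
  ydhom_coact : forall m, coact (f m) = \tsum_(h, m0 <- coact m) h ⊠ f m0
}.

Definition ydunit : ydData :=
  @YDData k^o (fun h c => hcounit h * c) (fun c => 1 ⊠ c).

Definition ydtensor (M N : ydData) : ydData := @YDData (M ⊗ N)
  (fun h t => \tsum_(h1, h2 <- hcomul h) \tsum_(m, n <- t) act h1 m ⊠ act h2 n)
  (fun t => \tsum_(m, n <- t) \tsum_(g, m0 <- coact m) \tsum_(h, n0 <- coact n)
     (g * h) ⊠ (m0 ⊠ n0)).

Definition braiding (M N : ydData) (t : M ⊗ N) : N ⊗ M :=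
  \tsum_(m, n <- t) \tsum_(h, m0 <- coact m) act h n ⊠ m0.

(* M is the direct sum of its Yetter-Drinfeld submodules gr 0, gr 1, ... *)
Record isGrading (M : ydData) (gr : nat -> {pred M}) : Prop := {
  gr_submod : forall n, GRing.submod_closed (gr n);
  gr_act : forall n h m, m \in gr n -> act h m \in gr n;
  gr_coact : forall n m, m \in gr n -> tensor_sub predT (gr n) (coact m);
  gr_sum : forall m, exists N (f : nat -> M),
    (forall n, f n \in gr n) /\ m = \sum_(n < N) f n;
  gr_direct : forall N (f : nat -> M), (forall n, f n \in gr n) ->
    \sum_(n < N) f n = 0 -> forall n, (n < N)%N -> f n = 0
}.

Record braidedHopfData := BraidedHopfData {
  bh_alg :> algType k;
  bh_act : H -> bh_alg -> bh_alg;
  bh_coact : bh_alg -> H ⊗ bh_alg;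
  bcomul : bh_alg -> bh_alg ⊗ bh_alg;
  bcounit : bh_alg -> k;
  banti : bh_alg -> bh_alg;
  grade : nat -> {pred bh_alg}
}.

Arguments grade : clear implicits.

Definition ydof (R : braidedHopfData) : ydData := YDData (@bh_act R) (@bh_coact R).

(* N-graded Hopf algebras in the braided category of Yetter-Drinfeld modules:  *)
(* all the structure maps are morphisms of the category, and bcomul is         *)
(* multiplicative for the product (m ⊗ m)(id ⊗ braiding ⊗ id) on R ⊗ R.        *)
Record isGradedBraidedHopf (R : braidedHopfData) : Prop := {
  bh_yd : isYD (ydof R);
  bmul_hom : @isYDHom (ydtensor (ydof R) (ydof R)) (ydof R)
    (fun t => \tsum_(x, y <- t) ((x : R) * y));
  bunit_hom : @isYDHom ydunit (ydof R) (fun c => c *: (1 : R));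
  bh_coalgebra : isCoalgebra (@bcomul R) (@bcounit R);
  bcomul_hom : @isYDHom (ydof R) (ydtensor (ydof R) (ydof R)) (@bcomul R);
  bcounit_hom : @isYDHom (ydof R) ydunit (@bcounit R);
  bcomul1 : bcomul (1 : R) = 1 ⊠ 1;
  bcomulM : forall x y : R, bcomul (x * y) =
    \tsum_(x1, x2 <- bcomul x) \tsum_(y1, y2 <- bcomul y)
      \tsum_(z, w <- @braiding (ydof R) (ydof R) (x2 ⊠ y1)) (x1 * z) ⊠ (w * y2);
  bcounit1 : bcounit (1 : R) = 1;
  bcounitM : forall x y : R, bcounit (x * y) = bcounit x * bcounit y;
  bh_antipode : isAntipode (@bcomul R) (@bcounit R) (@banti R);
  banti_hom : @isYDHom (ydof R) (ydof R) (@banti R);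
  bh_grading : @isGrading (ydof R) (grade R);
  grade1 : (1 : R) \in grade R 0;
  gradeM : forall m n (x y : R),
    x \in grade R m -> y \in grade R n -> x * y \in grade R (m + n);
  grade_comul : forall n (x : R), x \in grade R n ->
    exists2 t : 'I_n.+1 -> R ⊗ R,
      forall i : 'I_n.+1, tensor_sub (grade R i) (grade R (n - i)) (t i) &
      bcomul x = \sum_i t i;
  grade_counit : forall n (x : R), (0 < n)%N -> x \in grade R n -> bcounit x = 0;
  grade_anti : forall n (x : R), x \in grade R n -> banti x \in grade R n
}.

Definition primitive (R : braidedHopfData) (x : R) : Prop :=
  bcomul x = x ⊠ 1 + 1 ⊠ x.

(* R, with the embedding iota of V as R(1), is the Nichols algebra of V. *)
Record isNichols (V : ydModule) (R : braidedHopfData) (iota : V -> R) : Prop := {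
  nichols_hopf : isGradedBraidedHopf R;
  nichols0 : forall x : R, x \in grade R 0 <-> exists c : k, x = c *: 1;
  nichols_hom : @isYDHom V (ydof R) iota;
  nichols_inj : injective iota;
  nichols1 : forall x : R, x \in grade R 1 <-> exists v : V, x = iota v;
  nichols_prim : forall x : R, x \in grade R 1 <-> primitive x;
  nichols_gen : forall S : {pred R}, GRing.subalg_closed S ->
    {subset grade R 1 <= S} -> forall x : R, x \in S
}.

End YetterDrinfeld.

Section Presentations.
Variable k : fieldType.

Definition freeAlg n := {malg k[{fmonom 'I_n}]}.
Definition fgen n (i : 'I_n) : freeAlg n := << fmu i >>.

Definition free_eval (A : algType k) n (g : 'I_n -> A) (p : freeAlg n) : A :=
  mmap (in_alg A) (fun w : {fmonom 'I_n} => \prod_(i <- (w : seq 'I_n)) g i) p.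

Definition in_ideal n (rels : seq (freeAlg n)) (p : freeAlg n) : Prop :=
  exists2 s : seq (freeAlg n * freeAlg n * freeAlg n),
    all (fun t => t.1.2 \in rels) s & p = \sum_(t <- s) t.1.1 * t.1.2 * t.2.

(* X_i |-> g i induces an isomorphism from k<X_0, ..., X_(n-1)> / (rels) to A. *)
Definition presents (A : algType k) n (g : 'I_n -> A) (rels : seq (freeAlg n)) : Prop :=
  (forall x : A, exists p, free_eval g p = x) /\
  (forall p, free_eval g p = 0 <-> in_ideal rels p).

Definition has_dim (V : lmodType k) (n : nat) : Prop :=
  exists2 f : V -> 'rV[k]_n, linear f & bijective f.

End Presentations.

Section TheHopfAlgebraK.
Variables (k : fieldType) (xi : k).

Definition K_rels : seq (freeAlg k 4) :=
  let a := fgen k (0 : 'I_4) in let b := fgen k (1 : 'I_4) in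
  let c := fgen k (2 : 'I_4) in let d := fgen k (3 : 'I_4) in
  [:: a * b - xi *: (b * a); a * c - xi *: (c * a); c * b; b * c;
      c * d - xi *: (d * c); b * d - xi *: (d * b); a * d - d * a; a * d - 1;
      b ^+ 2; c ^+ 2; a ^+ 2 * c - b; a ^+ 4 - 1].

Record isK (K : hopfAlg k) (a b c d : K) : Prop := {
  K_presents : presents (fun i : 'I_4 => [:: a; b; c; d]`_i) K_rels;
  K_comul_a : hcomul a = a ⊠ a + b ⊠ c;
  K_comul_b : hcomul b = a ⊠ b + b ⊠ d;
  K_comul_c : hcomul c = c ⊠ a + d ⊠ c;
  K_comul_d : hcomul d = c ⊠ b + d ⊠ d;
  K_counit_a : hcounit a = 1;
  K_counit_b : hcounit b = 0;
  K_counit_c : hcounit c = 0;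
  K_counit_d : hcounit d = 1;
  K_anti_a : hanti a = d;
  K_anti_b : hanti b = xi *: b;
  K_anti_c : hanti c = - xi *: c;
  K_anti_d : hanti d = a
}.

(* V is V_(i,1), with i taken modulo 4 since xi ^+ 4 = 1. *)
Record isVi1 (K : hopfAlg k) (a b c d : K) (i : nat) (V : ydModule K) (e1 e2 : V)
    (l := xi ^+ i) : Prop := {
  V_basis : forall v : V, exists! x : k * k, v = x.1 *: e1 + x.2 *: e2;
  V_a1 : act a e1 = l *: e1;
  V_b1 : act b e1 = 0;
  V_c1 : act c e1 = 0;
  V_d1 : act d e1 = l^-1 *: e1;
  V_a2 : act a e2 = - (xi * l) *: e2;
  V_b2 : act b e2 = l ^+ 2 *: e1;
  V_c2 : act c e2 = e1;
  V_d2 : act d e2 = (xi * l^-1) *: e2;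
  V_coact1 : coact e1 = d ⊠ e1 + ((l ^+ 3 - xi * l) *: c) ⊠ e2;
  V_coact2 : coact e2 = a ⊠ e2 + ((2^-1 * (l + xi * l ^+ 3)) *: b) ⊠ e1
}.

End TheHopfAlgebraK.

Definition nichols_rels (k : fieldType) : seq (freeAlg k 2) :=
  let x := fgen k (0 : 'I_2) in let y := fgen k (1 : 'I_2) in
  [:: x ^+ 2 - 2 *: y ^+ 2; x * y + y * x; y ^+ 4].

(* Main.v *)
From HB Require Import structures.
Require Import Defs.
From mathcomp Require Import all_boot all_order all_algebra.
From mathcomp Require Import finmap boolp monalg ring.

(** Write x and y for the images of e1 and e2 in the Nichols algebra R, and
    kap = (1 + xi) / 2. Then the action and coaction of V read
    a x = -xi x, a y = -y, b y = -x, c y = x, d x = xi x, d y = -y,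
    b x = c x = 0, and
    x |-> d ⊗ x + (xi - 1) c ⊗ y, y |-> a ⊗ y - kap b ⊗ x.

    The relations hold because each of them is a primitive element of degree
    greater than one, and all primitive elements of a Nichols algebra have degree
    one. Since Delta (v r) is the product of v ⊗ 1 + 1 ⊗ v and Delta r for v in V
    ([comul_mul_primitive]), the coproducts of words are computed from the
    left, letter by letter. In degree two this gives x^2 = 2 y^2 and yx = -xy
    ([xxE], [yxE]); these determine the action of a, b, c, d on y^2 and y^3, and
    one further step shows that y^4 is primitive ([y4E]).

    The relations reduce every word to a combination of the eight monomials y^j
    and x y^j with j < 4 ([exists_normal_form]), so it remains to see that these
    are linearly independent in R. Multiplying a vanishing combination by
    powers of y on the right and by x on the left isolates its coefficients one
    after the other, each as a multiple of x y^3. Thus everything rests on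
    x y^3 being nonzero ([xy3_neq0]): contracting the right factor of the coproduct
    with the linear form that reads the coefficient of x in degree one
    ([exists_first_coordinate]) sends x y^3, y^3, xy successively to nonzero
    multiples of y^3, xy, y. *)

Set Implicit Arguments.
Unset Strict Implicit.
Unset Printing Implicit Defensive.

Import GRing.Theory.
Local Open Scope ring_scope.
Local Notation "h ▷ u" := (bh_act h u) (at level 35, right associativity).

(** * Linear maps and tensor products *)

Section LinearMaps.
Variables (k : fieldType) (U W : lmodType k) (f : U -> W).
Hypothesis f_lin : linear f.

Lemma linearmap0 : f 0 = 0.
Proof. by have := f_lin (-1) 0 0; rewrite scaler0 addr0 scaleN1r addNr. Qed.

Lemma linearmapD : {morph f : u v / u + v}.
Proof. by move=> u v; have := f_lin 1 u v; rewrite !scale1r. Qed.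

Lemma linearmapZ c : {morph f : u / c *: u}.
Proof. by move=> u; have := f_lin c u 0; rewrite linearmap0 !addr0. Qed.

Lemma linearmapN : {morph f : u / - u}.
Proof. by move=> u; rewrite -scaleN1r linearmapZ scaleN1r. Qed.

Lemma linearmap_sum (I : Type) (r : seq I) (P : pred I) (F : I -> U) :
  f (\sum_(i <- r | P i) F i) = \sum_(i <- r | P i) f (F i).
Proof. exact: (big_morph f linearmapD linearmap0). Qed.

End LinearMaps.

Section TensorLift.
Variables (k : fieldType) (V W U U' : lmodType k).
Implicit Types (f g : V -> W -> U) (t : V ⊗ W).

Lemma eq_tlift f g t : (forall v w, f v w = g v w) -> tlift f t = tlift g t.
Proof. by move=> fg; apply: eq_bigr => p _; rewrite fg. Qed.

Lemma tlift_linear_fun c f g t :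
  tlift (fun v w => c *: f v w + g v w) t = c *: tlift f t + tlift g t.
Proof.
rewrite /tlift scaler_sumr -big_split; apply: eq_bigr => p _ /=.
by rewrite scalerDr !scalerA mulrC.
Qed.

Lemma tlift_add_fun f g t :
  tlift f t + tlift g t = tlift (fun v w => f v w + g v w) t.
Proof.
by rewrite /tlift -big_split; apply: eq_bigr => p _; rewrite /= scalerDr.
Qed.

Lemma linear_tlift (h : U -> U') f t : linear h ->
  h (tlift f t) = tlift (fun v w => h (f v w)) t.
Proof.
move=> h_lin; rewrite /tlift linearmap_sum //.
by apply: eq_bigr => p _; rewrite linearmapZ.
Qed.

Lemma bilinear_tlift (T : U' -> V -> W -> U) t :
  (forall v w, linear (fun u => T u v w)) -> linear (fun u => tlift (T u) t).
Proof.
move=> T_lin c u u'; rewrite -(tlift_linear_fun c (T u) (T u')).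
by apply: eq_tlift => v w; rewrite T_lin.
Qed.

End TensorLift.

Section PureTensors.
Variables (k : fieldType) (V W : lmodType k).
Implicit Types (v : V) (w : W).

Lemma linear_tpurel w : linear (fun v => v ⊠ w).
Proof. exact: (tpure_bilinear V W).2. Qed.

Lemma linear_tpurer v : linear (fun w => v ⊠ w).
Proof. exact: (tpure_bilinear V W).1. Qed.

Lemma tpureZl c v w : (c *: v) ⊠ w = c *: v ⊠ w.
Proof. exact: (linearmapZ (linear_tpurel w)). Qed.

End PureTensors.

(** * Multiplication by a primitive element of a braided Hopf algebra *)

Section BraidedHopf.
Variables (k : fieldType) (H : hopfAlg k) (R : braidedHopfData H).
Hypothesis R_hopf : isGradedBraidedHopf R.
Implicit Types (h : H) (u v r : R).

Lemma linear_actr h : linear (fun u : R => h ▷ u).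
Proof. exact: (act_bilinear (bh_yd R_hopf)).1. Qed.

Lemma linear_actl u : linear (fun h => h ▷ u).
Proof. exact: (act_bilinear (bh_yd R_hopf)).2. Qed.

Lemma act_unit u : (1 : H) ▷ u = u.
Proof. exact: (act1 (bh_yd R_hopf)). Qed.

Lemma linear_coact : linear (@bh_coact k H R).
Proof. exact: (coact_linear (bh_yd R_hopf)). Qed.

(** The product of R is a morphism of modules. *)
Lemma act_mul h u v :
  h ▷ (u * v) = \tsum_(h1, h2 <- hcomul h) ((h1 ▷ u) * (h2 ▷ v)).
Proof.
have mul_bil : bilinear_map (fun x y : R => x * y).
  by split=> [x|y] c r s; rewrite ?mulrDr ?mulrDl -?scalerAr -?scalerAl.
have act_bil h1 h2 : bilinear_map (fun x y : R => (h1 ▷ x) ⊠ (h2 ▷ y)).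
  split=> [x|y] c r s.
    by rewrite linear_actr linear_tpurer.
  by rewrite linear_actr linear_tpurel.
have := ydhom_act (bmul_hom R_hopf) h (u ⊠ v).
rewrite /= tlift_pure // => <-.
rewrite linear_tlift; last exact: tlift_linear.
apply: eq_tlift => h1 h2; rewrite tlift_pure //.
by rewrite tlift_pure.
Qed.

Lemma act_one h : h ▷ (1 : R) = hcounit h *: 1.
Proof.
have := ydhom_act (bunit_hom R_hopf) h (1 : k^o).
by rewrite /= mulr1 scale1r => <-.
Qed.

Lemma coact_one : @bh_coact k H R 1 = 1 ⊠ 1.
Proof.
have := ydhom_coact (bunit_hom R_hopf) (1 : k^o).
rewrite /= scale1r => ->; rewrite tlift_pure ?scale1r //.
split=> [h|c] e x y.
  by rewrite scalerDl -scalerA linear_tpurer.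
by rewrite linear_tpurel.
Qed.

(** The map t |-> (u ⊗ 1 + 1 ⊗ u) t for the braided product of R ⊗ R: moving u
    past the left factor r of a tensor r ⊗ s lets its coaction act on r. *)
Definition primitive_mul (u : R) (t : R ⊗ R) : R ⊗ R :=
  \tsum_(r, s <- t)
    ((u * r) ⊠ s + \tsum_(h, u0 <- bh_coact u) (h ▷ r) ⊠ (u0 * s)).

Let mul_act_bilinear r s :
  bilinear_map (fun h u0 => (h ▷ r) ⊠ (u0 * s)).
Proof.
split=> [h|u0] c x y; last by rewrite linear_actl linear_tpurel.
by rewrite mulrDl -scalerAl linear_tpurer.
Qed.

Let braiding_bilinear :
  bilinear_map (fun u r : R => \tsum_(h, u0 <- bh_coact u) (h ▷ r) ⊠ u0).
Proof.
have bil r : bilinear_map (fun h (u0 : R) => (h ▷ r) ⊠ u0).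
  split=> [h|u0] c x y; first by rewrite linear_tpurer.
  by rewrite linear_actl linear_tpurel.
split=> [u|r].
  by apply: bilinear_tlift => h u0 c x y; rewrite linear_actr linear_tpurel.
by move=> c x y; rewrite linear_coact tlift_linear.
Qed.

Lemma primitive_mul_bilinear u :
  bilinear_map (fun r s : R =>
    (u * r) ⊠ s + \tsum_(h, u0 <- bh_coact u) (h ▷ r) ⊠ (u0 * s)).
Proof.
split=> [r|s] c x y; rewrite scalerDr addrACA.
  rewrite linear_tpurer; congr (_ + _); move: c x y.
  apply: bilinear_tlift => h u0 c x y.
  by rewrite mulrDr -scalerAr linear_tpurer.
rewrite mulrDr -scalerAr linear_tpurel; congr (_ + _); move: c x y.
by apply: bilinear_tlift => h u0 c x y; rewrite linear_actr linear_tpurel.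
Qed.

Lemma linear_primitive_mul u : linear (primitive_mul u).
Proof. exact: tlift_linear (primitive_mul_bilinear u). Qed.

Lemma primitive_mul_pure (h1 h2 : H) u u1 u2 r s :
  bh_coact u = h1 ⊠ u1 + h2 ⊠ u2 ->
  primitive_mul u (r ⊠ s) =
    (u * r) ⊠ s + ((h1 ▷ r) ⊠ (u1 * s) + (h2 ▷ r) ⊠ (u2 * s)).
Proof.
move=> coact_u; rewrite /primitive_mul (tlift_pure (primitive_mul_bilinear u)).
rewrite coact_u linearmapD; last exact: tlift_linear (mul_act_bilinear r s).
by rewrite !(tlift_pure (mul_act_bilinear r s)).
Qed.

Lemma act_mul2 (h h1 h2 h3 h4 : H) u v : hcomul h = h1 ⊠ h2 + h3 ⊠ h4 ->
  h ▷ (u * v) = (h1 ▷ u) * (h2 ▷ v) + (h3 ▷ u) * (h4 ▷ v).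
Proof.
have bil : bilinear_map (fun h1 h2 : H => (h1 ▷ u) * (h2 ▷ v)).
  split=> [g|g] c x y.
    by rewrite linear_actl mulrDr -scalerAr.
  by rewrite linear_actl mulrDl -scalerAl.
move=> comul_h; rewrite act_mul comul_h linearmapD; last exact: tlift_linear.
by rewrite !tlift_pure.
Qed.

(** Multiplicativity of the coproduct, with the two summands v ⊗ 1 and 1 ⊗ v of
    the first factor braided past r. It reduces the coproduct of a word in
    degree-one generators to their action and coaction. *)
Lemma comul_mul_primitive (v r : R) : primitive v ->
  bcomul (v * r) = primitive_mul v (bcomul r).
Proof.
move=> v_prim.
have mul_bil (x1 y2 : R) : bilinear_map (fun z w : R => (x1 * z) ⊠ (w * y2)).
  split=> [x|y] c s t.
    by rewrite mulrDl -scalerAl linear_tpurer.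
  by rewrite mulrDr -scalerAr linear_tpurel.
have braid_lin : linear (@braiding k H (ydof R) (ydof R)).
  exact: tlift_linear.
pose B (x1 x2 y1 y2 : R) :=
  \tsum_(z, w <- @braiding k H (ydof R) (ydof R) (x2 ⊠ y1)) (x1 * z) ⊠ (w * y2).
have B_bil : bilinear_map (fun x1 x2 => \tsum_(y1, y2 <- bcomul r) B x1 x2 y1 y2).
  split=> [x1|x2]; apply: bilinear_tlift => y1 y2.
    by move=> c s t; rewrite /B linear_tpurel braid_lin tlift_linear.
  by apply: bilinear_tlift => z w c s t; rewrite mulrDl -scalerAl linear_tpurel.
transitivity (\tsum_(y1, y2 <- bcomul r) B v 1 y1 y2 +
              \tsum_(y1, y2 <- bcomul r) B 1 v y1 y2).
  rewrite (bcomulM R_hopf) v_prim linearmapD; last exact: tlift_linear B_bil.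
  exact: (congr2 +%R (tlift_pure B_bil v 1) (tlift_pure B_bil 1 v)).
rewrite tlift_add_fun; apply: eq_tlift => r1 r2; congr (_ + _).
(* v ⊗ 1: the unit is coinvariant and is braided trivially past r1 *)
- rewrite /B /braiding (tlift_pure braiding_bilinear) /= coact_one.
  rewrite tlift_pure; last first.
    split=> [h|u0] c x y; first by rewrite linear_tpurer.
    by rewrite linear_actl linear_tpurel.
  by rewrite act_unit (tlift_pure (mul_bil _ _)) mul1r.
- rewrite /B /braiding (tlift_pure braiding_bilinear) /=.
  rewrite linear_tlift; last exact: tlift_linear.
  by apply: eq_tlift => h u0; rewrite (tlift_pure (mul_bil _ _)) mul1r.
Qed.

End BraidedHopf.

(** * Homogeneous components *)

Section Gradings.
Variables (k : fieldType) (H : hopfAlg k) (M : ydData H).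
Variables (gr : nat -> {pred M}) (gr_M : isGrading gr).

Lemma graded0 n : 0 \in gr n.
Proof. by case: (gr_submod gr_M n). Qed.

Lemma gradedZD n c x y : x \in gr n -> y \in gr n -> c *: x + y \in gr n.
Proof. by move=> xn yn; case: (gr_submod gr_M n) => _ ->. Qed.

(** The sum is required to equal m for all large N, so that two decompositions
    of different lengths can be added and compared termwise. *)
Definition decomposition (m : M) (f : nat -> M) : Prop :=
  (forall n, f n \in gr n) /\
  (exists N, forall N', (N <= N')%N -> m = \sum_(i < N') f i).

Lemma decompositionZD c m m' f f' : decomposition m f -> decomposition m' f' ->
  decomposition (c *: m + m') (fun n => c *: f n + f' n).
Proof.
move=> [f_gr [N mN]] [f'_gr [N' m'N]]; split=> [n|]; first exact: gradedZD.
exists (maxn N N') => P; rewrite geq_max => /andP[NP N'P].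
by rewrite {1}(mN P) // (m'N P) // scaler_sumr -big_split.
Qed.

Lemma decomposition0 f : decomposition 0 f -> forall n, f n = 0.
Proof.
move=> [f_gr [N fN]] n.
apply: (gr_direct gr_M f_gr (N := maxn N n.+1)); last exact: leq_maxr.
by rewrite -fN ?leq_maxl.
Qed.

Lemma decomposition_inj m f f' : decomposition m f -> decomposition m f' ->
  forall n, f n = f' n.
Proof.
move=> mf mf' n; apply/eqP; rewrite -subr_eq0 addrC -scaleN1r; apply/eqP.
have m0 : -1 *: m + m = 0 by rewrite scaleN1r addNr.
by have := decompositionZD (-1) mf' mf; rewrite m0 => /decomposition0 ->.
Qed.

Lemma exists_decomposition m : exists f, decomposition m f.
Proof.
have [N [f [f_gr ->]]] := gr_sum gr_M m.
exists (fun n => if (n < N)%N then f n else 0); split=> [n|].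
  by case: ifP => _ //; exact: graded0.
exists N => N' leN; rewrite (big_ord_widen N' f leN) big_mkcond.
by apply: eq_bigr => i _.
Qed.

Lemma decomposition_homogeneous n m : m \in gr n ->
  decomposition m (fun i => if i == n then m else 0).
Proof.
move=> m_n; split=> [i|]; first by case: eqP => [->|_] //; exact: graded0.
exists n.+1 => N ltnN; rewrite -big_mkcond (big_pred1 (Ordinal ltnN)) //.
Qed.

(** The projection onto one graded piece: by directness of the sum, the piece
    of degree n depends linearly on the element. *)
Lemma exists_component n : exists2 p : M -> M, linear p &
  [/\ forall m, p m \in gr n, forall m, m \in gr n -> p m = m &
      forall i m, i <> n -> m \in gr i -> p m = 0].
Proof.
have [F decF] := choice exists_decomposition.
exists (fun m => F m n) => [c x y|].
  by rewrite (decomposition_inj (decF _) (decompositionZD c (decF x) (decF y))).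
split=> [m|m m_n|i m in_ m_i]; first by case: (decF m).
  by rewrite (decomposition_inj (decF m) (decomposition_homogeneous m_n)) eqxx.
rewrite (decomposition_inj (decF m) (decomposition_homogeneous m_i)).
by case: eqP => // /esym.
Qed.

End Gradings.

(** * Coproducts of words in x and y *)

(** The tensor square and the structure maps of the Nichols algebra appear below
    as an arbitrary target T with a bilinear map and as arbitrary maps; mulx and
    muly stand for the multiplications by x ⊗ 1 + 1 ⊗ x and y ⊗ 1 + 1 ⊗ y, and
    a, b, c, d for the actions of the generators. Only the displayed identities
    enter the computation, which therefore takes place in an arbitrary module. *)
Section CoproductComputations.
Variables (k : fieldType) (xi : k).
Hypotheses (two_neq0 : 2 != 0 :> k) (xi2 : xi ^+ 2 = -1).
Let kap : k := (1 + xi) / 2.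

Variables (R : algType k) (x y : R) (T : lmodType k) (tens : R -> R -> T).
Local Notation "r ⊗ s" := (tens r s).
Hypothesis tens_bilinear : bilinear_map tens.

Variables (a b c d : R -> R).
Hypothesis a_gens : [/\ a 1 = 1, a x = - xi *: x & a y = - y].
Hypothesis b_gens : [/\ b 1 = 0, b x = 0 & b y = - x].
Hypothesis c_gens : [/\ c 1 = 0, c x = 0 & c y = x].
Hypothesis d_gens : [/\ d 1 = 1, d x = xi *: x & d y = - y].
Hypothesis aM : forall u v, a (u * v) = a u * a v + b u * c v.
Hypothesis bM : forall u v, b (u * v) = a u * b v + b u * d v.
Hypothesis cM : forall u v, c (u * v) = c u * a v + d u * c v.
Hypothesis dM : forall u v, d (u * v) = c u * b v + d u * d v.

Variables (comul : R -> T) (mulx muly : T -> T).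
Hypotheses (comul_linear : linear comul).
Hypotheses (mulx_linear : linear mulx) (muly_linear : linear muly).
Hypothesis comul_x : comul x = x ⊗ 1 + 1 ⊗ x.
Hypothesis comul_y : comul y = y ⊗ 1 + 1 ⊗ y.
Hypothesis comul_xM : forall r, comul (x * r) = mulx (comul r).
Hypothesis comul_yM : forall r, comul (y * r) = muly (comul r).
Hypothesis mulx_pure : forall r s,
  mulx (r ⊗ s) = (x * r) ⊗ s + d r ⊗ (x * s) + (xi - 1) *: (c r ⊗ (y * s)).
Hypothesis muly_pure : forall r s,
  muly (r ⊗ s) = (y * r) ⊗ s + a r ⊗ (y * s) - kap *: (b r ⊗ (x * s)).

Variable deg : nat -> {pred R}.
Hypothesis degZD : forall n e u v, u \in deg n -> v \in deg n -> e *: u + v \in deg n.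
Hypothesis degM : forall m n u v, u \in deg m -> v \in deg n -> u * v \in deg (m + n).
Hypotheses (deg_x : x \in deg 1) (deg_y : y \in deg 1).
Hypothesis primitive_deg1 : forall n u,
  u \in deg n -> n <> 1%N -> comul u = u ⊗ 1 + 1 ⊗ u -> u = 0.

Let xi_mul : xi * xi = -1. Proof. by rewrite -expr2. Qed.

Let kap2 : kap *+ 2 = 1 + xi.
Proof. by rewrite -mulr_natr divfK. Qed.

Let kap_neq0 : kap != 0.
Proof.
apply/eqP => kap0; have xi_eq : xi = -1.
  by apply/eqP; rewrite -addr_eq0 addrC -kap2 kap0 mul0rn.
have := xi2; rewrite xi_eq sqrrN expr1n => /eqP.
by rewrite -addr_eq0 -(natrD _ 1 1) (negPf two_neq0).
Qed.

Let kap_kap_xi : kap * (kap * (2 * (xi *+ 2))) = - 2.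
Proof.
transitivity (kap *+ 2 * (kap *+ 2) * xi); first by ring.
rewrite kap2; transitivity (xi + 2 * xi ^+ 2 + xi ^+ 2 * xi); first by ring.
by rewrite xi2; ring.
Qed.

Let tDl r r' s : (r + r') ⊗ s = r ⊗ s + r' ⊗ s.
Proof. exact: (linearmapD (tens_bilinear.2 s)). Qed.
Let tDr r s s' : r ⊗ (s + s') = r ⊗ s + r ⊗ s'.
Proof. exact: (linearmapD (tens_bilinear.1 r)). Qed.
Let tZl e r s : (e *: r) ⊗ s = e *: (r ⊗ s).
Proof. exact: (linearmapZ (tens_bilinear.2 s)). Qed.
Let tZr e r s : r ⊗ (e *: s) = e *: (r ⊗ s).
Proof. exact: (linearmapZ (tens_bilinear.1 r)). Qed.
Let tNl r s : (- r) ⊗ s = - (r ⊗ s).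
Proof. exact: (linearmapN (tens_bilinear.2 s)). Qed.
Let tNr r s : r ⊗ (- s) = - (r ⊗ s).
Proof. exact: (linearmapN (tens_bilinear.1 r)). Qed.
Let t0l s : 0 ⊗ s = 0.
Proof. exact: (linearmap0 (tens_bilinear.2 s)). Qed.

Let a1 : a 1 = 1. Proof. by case: a_gens. Qed.
Let ax : a x = - xi *: x. Proof. by case: a_gens. Qed.
Let ay : a y = - y. Proof. by case: a_gens. Qed.
Let b1 : b 1 = 0. Proof. by case: b_gens. Qed.
Let bx : b x = 0. Proof. by case: b_gens. Qed.
Let b_y : b y = - x. Proof. by case: b_gens. Qed.
Let c1 : c 1 = 0. Proof. by case: c_gens. Qed.
Let cx : c x = 0. Proof. by case: c_gens. Qed.
Let cy : c y = x. Proof. by case: c_gens. Qed.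
Let d1 : d 1 = 1. Proof. by case: d_gens. Qed.
Let dx : d x = xi *: x. Proof. by case: d_gens. Qed.
Let dy : d y = - y. Proof. by case: d_gens. Qed.
Let mulxD := linearmapD mulx_linear.
Let mulxZ := linearmapZ mulx_linear.
Let mulxN := linearmapN mulx_linear.
Let mulyD := linearmapD muly_linear.
Let mulyZ := linearmapZ muly_linear.
Let mulyN := linearmapN muly_linear.

Lemma comul_xx : comul (x * x) = (x * x) ⊗ 1 + (1 + xi) *: (x ⊗ x) + 1 ⊗ (x * x).
Proof.
rewrite comul_xM comul_x mulxD !mulx_pure dx cx d1 c1 !t0l !scaler0 !addr0 !mulr1.
by rewrite tZl scalerDl scale1r [LHS](AC (2*2) (1*(3*2)*4)).
Qed.

Lemma comul_yy : comul (y * y) = (y * y) ⊗ 1 + kap *: (x ⊗ x) + 1 ⊗ (y * y).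
Proof.
rewrite comul_yM comul_y mulyD !muly_pure ay b_y a1 b1 t0l scaler0 subr0 !mulr1.
by rewrite !tNl scalerN opprK [LHS](AC (3*2) (1*3*5*(4*2))) /= subrr addr0.
Qed.

Lemma comul_xy : comul (x * y) =
  (x * y) ⊗ 1 + xi *: (x ⊗ y) - y ⊗ x + 1 ⊗ (x * y).
Proof.
rewrite comul_xM comul_y mulxD !mulx_pure dy cy d1 c1 t0l scaler0 addr0 !mulr1.
rewrite tNl [LHS](AC (3*2) (1*(3*4)*2*5)) /=.
by rewrite -[X in _ *: _ + X]scale1r -scalerDl subrK.
Qed.

Lemma comul_yx : comul (y * x) =
  (y * x) ⊗ 1 - xi *: (x ⊗ y) + y ⊗ x + 1 ⊗ (y * x).
Proof.
rewrite comul_yM comul_x mulyD !muly_pure ax bx a1 b1 !t0l !scaler0 !subr0 !mulr1.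
by rewrite tZl scaleNr !addrA.
Qed.

(** x^2 - 2 y^2 is primitive of degree 2, because the coefficients 1 + xi and kap of x ⊗ x in
    the coproducts of x^2 and y^2 satisfy 1 + xi = 2 kap. *)
Lemma xxE : x * x = (y * y) *+ 2.
Proof.
apply/eqP; rewrite -subr_eq0 -scaler_nat addrC -scaleNr; apply/eqP.
apply: (@primitive_deg1 2) => //; first by rewrite degZD ?(@degM 1 1).
rewrite comul_linear comul_xx comul_yy -kap2 tDl tDr tZl tZr !scalerDr scalerA.
rewrite mulNr mulr_natl scaleNr [LHS](AC (3*3) ((1*4)*(3*6)*(2*5))) /=.
by rewrite !scaleNr addNr addr0.
Qed.

(** The mixed terms of the coproducts of xy and yx cancel, so that xy + yx is
    primitive of degree 2. *)
Lemma yxE : y * x = - (x * y).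
Proof.
apply/eqP; rewrite -addr_eq0 -[y * x]scale1r; apply/eqP.
apply: (@primitive_deg1 2) => //; first by rewrite degZD ?(@degM 1 1).
rewrite comul_linear comul_yx comul_xy !scale1r tDl tDr.
rewrite [LHS](AC (4*4) ((1*5)*(4*8)*(2*6)*(3*7))) /=.
by rewrite addNr subrr !addr0.
Qed.

Let a_yy : a (y * y) = - (y * y).
Proof. by rewrite aM ay b_y cy mulrNN mulNr xxE mulr2n opprD addrA subrr sub0r. Qed.
Let b_yy : b (y * y) = 0.
Proof. by rewrite bM ay b_y dy !mulrNN yxE addNr. Qed.
Let c_yy : c (y * y) = 0.
Proof. by rewrite cM ay dy cy mulrN mulNr yxE opprK addNr. Qed.
Let d_yy : d (y * y) = - (y * y).
Proof. by rewrite dM cy b_y dy mulrNN mulrN xxE mulr2n opprD -addrA addNr addr0. Qed.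

Lemma comul_yyy : comul (y * (y * y)) =
  (y * (y * y)) ⊗ 1 - (y * y) ⊗ y - kap *: ((x * y) ⊗ x)
  + (kap * xi) *: (x ⊗ (x * y)) + y ⊗ (y * y) + 1 ⊗ (y * (y * y)).
Proof.
rewrite comul_yM comul_yy !mulyD mulyZ !muly_pure a_yy b_yy ax bx a1 b1.
rewrite !t0l !scaler0 !subr0 !mulr1 !tNl yxE tNl tNr tZl scalerDr !scalerN.
by rewrite !scaleNr scalerN opprK scalerA !addrA.
Qed.

Let yxM u : y * (x * u) = - (x * (y * u)).
Proof. by rewrite mulrA yxE mulNr mulrA. Qed.

Let a_yyy : a (y * (y * y)) = y * (y * y).
Proof. by rewrite aM ay a_yy c_yy mulr0 addr0 mulrNN. Qed.
Let b_yyy : b (y * (y * y)) = x * (y * y).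
Proof. by rewrite bM b_y b_yy d_yy mulr0 add0r mulrNN. Qed.
Let d_yyy : d (y * (y * y)) = y * (y * y).
Proof. by rewrite dM dy b_yy d_yy mulr0 add0r mulrNN. Qed.
Let a_xy : a (x * y) = xi *: (x * y).
Proof. by rewrite aM ax ay bx mul0r addr0 scaleNr mulrNN scalerAl. Qed.
Let b_xy : b (x * y) = (xi *+ 2) *: (y * y).
Proof.
by rewrite bM ax b_y bx mul0r addr0 scaleNr mulrNN -scalerAl xxE -scaler_nat scalerA mulr_natr.
Qed.

(** In degree 4 the intermediate terms cancel in pairs, except that
    y^2 ⊗ y^2 occurs with coefficient 1 + 1 + 4 kap^2 xi = 0, as
    kap^2 = xi / 2. Hence y^4 is primitive. *)
Lemma y4E : y * (y * (y * y)) = 0.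
Proof.
apply: (@primitive_deg1 4) => //.
  by rewrite (@degM 1 3) // (@degM 1 2) // (@degM 1 1).
rewrite comul_yM comul_yyy !mulyD !mulyN !mulyZ !muly_pure.
rewrite a_yyy b_yyy a_yy b_yy a_xy b_xy ax bx ay b_y a1 b1 !mulr1 !t0l !scaler0 !subr0.
rewrite !yxM yxE xxE -scaler_nat !(tNl, tNr, tZl, tZr) !(scalerN, scaleNr, opprK, scalerA).
rewrite !(scalerDr, scalerN, opprD, opprK, scalerA, addrA).
(* the fifteen summands, grouped by their pure tensors *)
rewrite [LHS](ACl ((1*15)*(2*4)*(6*3)*(7*9)*(14*12)*(5*11*8)*(10*13))) /=.
rewrite !subrr !addr0 kap_kap_xi -mulrA xi_mul mulrN1 !scaleNr addNr addr0.
by rewrite scaler_nat mulr2n subrr addr0.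
Qed.

Section TopMonomial.
(** ev is id ⊗ f, where f reads the coefficient of x in degree one; ev o comul
    is then a skew derivation of R. *)
Variables (f : R -> k) (ev : T -> R).
Hypotheses (ev_linear : linear ev) (ev_pure : forall r s, ev (r ⊗ s) = f s *: r).
Hypotheses (f1 : f 1 = 0) (fx : f x = 1) (fy : f y = 0).
Hypothesis f_deg : forall n u, u \in deg n -> n <> 1%N -> f u = 0.
Hypothesis y_neq0 : y != 0.

Let evD := linearmapD ev_linear.
Let evZ := linearmapZ ev_linear.
Let evN := linearmapN ev_linear.
Let evE := (evD, evZ, evN, ev_pure).

Let deg2 u v : u \in deg 1 -> v \in deg 1 -> u * v \in deg 2.
Proof. exact: degM. Qed.
Let deg3 u v w : u \in deg 1 -> v \in deg 1 -> w \in deg 1 -> u * (v * w) \in deg 3.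
Proof. by move=> u1 v1 w1; apply: (@degM 1 2) => //; apply: deg2. Qed.
Let deg4 u v w t : u \in deg 1 -> v \in deg 1 -> w \in deg 1 -> t \in deg 1 ->
  u * (v * (w * t)) \in deg 4.
Proof. by move=> *; apply: (@degM 1 3) => //; apply: deg3. Qed.

Let f2 u v : u \in deg 1 -> v \in deg 1 -> f (u * v) = 0.
Proof. by move=> u1 v1; rewrite (f_deg (deg2 u1 v1)). Qed.
Let f3 u v w : u \in deg 1 -> v \in deg 1 -> w \in deg 1 -> f (u * (v * w)) = 0.
Proof. by move=> *; rewrite (@f_deg 3) ?deg3. Qed.
Let f4 u v w t : u \in deg 1 -> v \in deg 1 -> w \in deg 1 -> t \in deg 1 ->
  f (u * (v * (w * t))) = 0.
Proof. by move=> *; rewrite (@f_deg 4) ?deg4. Qed.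

Let fE := (f1, fx, fy, scale0r, scale1r, oppr0, scaler0, addr0, add0r).

Let f_mon := (f4 deg_x deg_y deg_y deg_y, f4 deg_y deg_y deg_y deg_y,
  f3 deg_x deg_x deg_y, f3 deg_y deg_x deg_y, f3 deg_x deg_y deg_y,
  f3 deg_y deg_y deg_y, f2 deg_x deg_x, f2 deg_x deg_y, f2 deg_y deg_x,
  f2 deg_y deg_y).

Let ev_xy : ev (comul (x * y)) = - y.
Proof. by rewrite comul_xy !evE f_mon !fE. Qed.

Let ev_yyy : ev (comul (y * (y * y))) = - kap *: (x * y).
Proof. by rewrite comul_yyy !evE !f_mon !fE scaleNr. Qed.

Let ev_xyyy : ev (comul (x * (y * (y * y)))) = - xi *: (y * (y * y)).
Proof.
rewrite comul_xM comul_yyy !mulxD !mulxN !mulxZ !mulx_pure !evE !mulr1.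
rewrite !f_mon !fE d_yyy.
have -> : x * (x * y) = 2 *: (y * (y * y)).
  by rewrite mulrA xxE mulrnAl -mulrA scaler_nat.
rewrite scalerA mulr_natr kap2.
by rewrite scalerDl scale1r opprD addrA subrr add0r scaleNr.
Qed.

(** Up to nonzero scalars the skew derivation ev o comul maps
    x y^3 to y^3, y^3 to x y, and x y to y, and y is not zero. *)
Lemma xy3_neq0 : x * (y * (y * y)) != 0.
Proof.
have ev0 r : r = 0 -> ev (comul r) = 0.
  by move=> ->; rewrite (linearmap0 comul_linear) (linearmap0 ev_linear).
have xi_neq0 : xi != 0.
  apply/eqP => xi0; have := xi_mul.
  by rewrite xi0 mul0r => /eqP; rewrite eq_sym oppr_eq0 oner_eq0.
apply/eqP => /ev0; rewrite ev_xyyy => /eqP.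
rewrite scaler_eq0 oppr_eq0 (negPf xi_neq0) /= => /eqP/ev0; rewrite ev_yyy => /eqP.
rewrite scaler_eq0 oppr_eq0 (negPf kap_neq0) /= => /eqP/ev0; rewrite ev_xy => /eqP.
by rewrite oppr_eq0 (negPf y_neq0).
Qed.

Lemma relations_from_coproduct : [/\ x * x = (y * y) *+ 2, y * x = - (x * y),
  y ^+ 4 = 0 & x * y ^+ 3 != 0].
Proof. by split; [exact: xxE|exact: yxE|exact: y4E|exact: xy3_neq0]. Qed.

End TopMonomial.

End CoproductComputations.

(** * The free algebra: evaluation and ideals *)

Section MonoidAlgebras.
Variables (k : fieldType) (M : monomType).

Lemma malgUZ (c : k) (m : M) : << c *g m >> = c *: << m >>.
Proof. by apply/malgP => v; rewrite mcoeffZ !mcoeffU mulr_natr. Qed.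

Lemma malg_scalerAr (c : k) (p q : {malg k[M]}) : p * (c *: q) = c *: (p * q).
Proof.
rewrite (malgMEw (fsubset_refl _) (msuppZ_le c q)) malgME scaler_sumr.
apply: eq_bigr => v _; rewrite scaler_sumr; apply: eq_bigr => w _.
by rewrite mcoeffZ mulrCA malgUZ [in RHS]malgUZ scalerA.
Qed.

End MonoidAlgebras.

Lemma mulr_regroup (B : pzRingType) (p q r s t : B) :
  p * (q * r * s) * t = p * q * r * (s * t).
Proof. by rewrite !mulrA. Qed.

Section FreeEval.
Variables (k : fieldType) (A : algType k) (n : nat) (g : 'I_n -> A).

Let word_eval (w : {fmonom 'I_n}) : A := \prod_(i <- (w : seq 'I_n)) g i.

Fact word_eval_mmorphism : mmorphism word_eval.
Proof.
split=> [v w|]; first by rewrite /word_eval fmM big_cat.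
by rewrite /word_eval fm1 big_nil.
Qed.

HB.instance Definition _ :=
  isMultiplicative.Build {fmonom 'I_n} A word_eval word_eval_mmorphism.

Lemma free_evalD : {morph free_eval g : p q / p + q}.
Proof. exact: mmapD. Qed.

Lemma free_evalZ c : {morph free_eval g : p / c *: p}.
Proof. by move=> p; rewrite /free_eval (mmapZ (h := word_eval)) mulr_algl. Qed.

Lemma free_eval1 : free_eval g 1 = 1.
Proof. exact: (mmap1 (h := word_eval)). Qed.

Lemma free_evalM : {morph free_eval g : p q / p * q}.
Proof.
apply: (commr_mmap_is_multiplicative (h := word_eval) _).1 => p m m' /=.
by rewrite /GRing.comm mulr_algl mulr_algr.
Qed.

Lemma linear_free_eval : linear (free_eval g).
Proof. by move=> c p q; rewrite free_evalD free_evalZ. Qed.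

Lemma free_evalN : {morph free_eval g : p / - p}.
Proof. exact: linearmapN linear_free_eval. Qed.

Lemma free_evalX m : {morph free_eval g : p / p ^+ m}.
Proof.
by move=> p; elim: m => [|m IH]; rewrite ?expr0 ?free_eval1 // !exprS free_evalM IH.
Qed.

Lemma free_eval_gen i : free_eval g (fgen k i) = g i.
Proof.
by rewrite /free_eval mmapU /= /word_eval fmU big_seq1 scale1r mul1r.
Qed.

Lemma free_eval_gen_exp i m : free_eval g (fgen k i ^+ m) = g i ^+ m.
Proof. by rewrite free_evalX free_eval_gen. Qed.

Lemma free_eval_gen_mul i j : free_eval g (fgen k i * fgen k j) = g i * g j.
Proof. by rewrite free_evalM; congr (_ * _); apply: free_eval_gen. Qed.

(** Every word is obtained from 1 by left multiplications by generators. *)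
Lemma freeAlg_ind (S : freeAlg k n -> Prop) : S 0 -> S 1 ->
  (forall c p q, S p -> S q -> S (c *: p + q)) ->
  (forall i p, S p -> S (fgen k i * p)) -> forall p, S p.
Proof.
move=> S0 S1 Slin Sgen p; rewrite [p]monalgE.
elim: (enum_fset (msupp p)) => [|w r IH]; first by rewrite big_nil.
rewrite big_cons malgUZ; apply: Slin; last exact: IH.
rewrite -[w]fmK.
elim: (fmonom_val w) => [|i s IHs].
  by rewrite (_ : FMonom [::] = mone) //; apply/eqP; rewrite fmP fm1.
have -> : << FMonom (i :: s) >> = fgen k i * (<< FMonom s >> : freeAlg k n).
  rewrite /fgen malgM_def fgmulUU mulr1; congr << _ >>.
  by apply/eqP; rewrite fmP fmM fmU.
exact: Sgen.
Qed.

End FreeEval.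

Section Ideals.
Variables (k : fieldType) (n : nat) (rels : seq (freeAlg k n)).
Implicit Types p q r : freeAlg k n.

Lemma in_ideal0 : in_ideal rels 0.
Proof. by exists [::]; rewrite ?big_nil. Qed.

Lemma in_idealD p q : in_ideal rels p -> in_ideal rels q -> in_ideal rels (p + q).
Proof.
move=> [s s_rels ->] [t t_rels ->].
by exists (s ++ t); rewrite ?all_cat ?s_rels ?big_cat.
Qed.

Lemma in_idealM p q r : in_ideal rels q -> in_ideal rels (p * q * r).
Proof.
move=> [s s_rels ->]; exists [seq (p * t.1.1, t.1.2, t.2 * r) | t <- s].
  by rewrite all_map.
rewrite big_map mulr_sumr mulr_suml; apply: eq_bigr => t _ /=.
exact: mulr_regroup.
Qed.

Lemma in_ideal_rel r : r \in rels -> in_ideal rels r.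
Proof.
by move=> rP; exists [:: (1, r, 1)]; rewrite /= ?rP // big_seq1 /= mul1r mulr1.
Qed.

Lemma in_idealZ e p : in_ideal rels p -> in_ideal rels (e *: p).
Proof.
by move=> /(@in_idealM e%:A _ 1); rewrite mulr1 mulr_algl.
Qed.

Lemma free_eval_ideal (A : algType k) (g : 'I_n -> A) p :
  {in rels, forall r, free_eval g r = 0} -> in_ideal rels p -> free_eval g p = 0.
Proof.
move=> rels0 [s /allP s_rels ->].
rewrite (linearmap_sum (linear_free_eval g)) big_seq big1 // => t /s_rels t_rel.
by rewrite !free_evalM (rels0 _ t_rel) mulr0 mul0r.
Qed.

End Ideals.

(** * Normal forms and the presentation *)

Section MonomialCombinations.
Variables (k : fieldType) (A : lalgType k) (u v : A).

(** The combination of v^j and u v^j, j < 4, with coefficient vector w; the index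
    type splits as 4 + 4 to separate the two families. *)
Definition monomial_comb (w : 'rV[k]_(4 + 4)) : A :=
  \sum_(j < 4) (w 0 (lshift 4 j) *: v ^+ j + w 0 (rshift 4 j) *: (u * v ^+ j)).

Lemma linear_monomial_comb : linear monomial_comb.
Proof.
move=> e w w'; rewrite scaler_sumr -big_split; apply: eq_bigr => j _ /=.
by rewrite !mxE !scalerDl scalerDr !scalerA addrACA.
Qed.

Lemma monomial_comb_delta_l j : monomial_comb (delta_mx 0 (lshift 4 j)) = v ^+ j.
Proof.
rewrite /monomial_comb (bigD1 j) //= big1 => [|i ij].
  by rewrite !mxE !eqxx eq_rlshift scale1r scale0r !addr0.
by rewrite !mxE eq_rlshift eq_lshift (negPf ij) !scale0r addr0.
Qed.

Lemma monomial_comb_delta_r j :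
  monomial_comb (delta_mx 0 (rshift 4 j)) = u * v ^+ j.
Proof.
rewrite /monomial_comb (bigD1 j) //= big1 => [|i ij].
  by rewrite !mxE !eqxx eq_lrshift scale1r scale0r add0r addr0.
by rewrite !mxE eq_lrshift eq_rshift (negPf ij) !scale0r addr0.
Qed.

End MonomialCombinations.

(** A left algebra F in which scalars are central, modulo a two-sided ideal I
    containing the three relations. Normal forms are stable under left
    multiplication by X and Y, which is all that an induction on words needs. *)
Section NormalForms.
Variables (k : fieldType) (F : lalgType k) (X Y : F) (I : F -> Prop).
Hypothesis mulrZ : forall (e : k) (p q : F), p * (e *: q) = e *: (p * q).
Hypotheses (I0 : I 0) (ID : forall p q, I p -> I q -> I (p + q)).
Hypothesis IZ : forall (e : k) p, I p -> I (e *: p).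
Hypothesis IM : forall p q r, I q -> I (p * q * r).
Hypothesis I_XX : I (X ^+ 2 - 2 *: Y ^+ 2).
Hypothesis I_XY : I (X * Y + Y * X).
Hypothesis I_Y4 : I (Y ^+ 4).
Implicit Types p q : F.

Definition has_normal_form p := exists w, I (p - monomial_comb X Y w).

Lemma nf_ideal p : I p -> has_normal_form p.
Proof.
by exists 0; rewrite (linearmap0 (linear_monomial_comb X Y)) subr0.
Qed.

Lemma nfZD e p q : has_normal_form p -> has_normal_form q ->
  has_normal_form (e *: p + q).
Proof.
move=> [w pw] [w' qw']; exists (e *: w + w').
rewrite linear_monomial_comb opprD addrACA -scalerBr.
exact/ID/qw'/IZ.
Qed.

Lemma nfZ e p : has_normal_form p -> has_normal_form (e *: p).
Proof.
move=> pP; rewrite -[e *: p]addr0; apply: nfZD => //.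
exact: nf_ideal.
Qed.

Lemma nfD p q : has_normal_form p -> has_normal_form q -> has_normal_form (p + q).
Proof. by rewrite -{2}[p]scale1r; apply: nfZD. Qed.

Lemma nf_eq_mod p q : I (p - q) ->
  has_normal_form q -> has_normal_form p.
Proof. by move=> /nf_ideal pq qP; rewrite -[p](subrK q); apply: nfD. Qed.

Lemma nf_sum (J : Type) (r : seq J) (f : J -> F) :
  (forall i, has_normal_form (f i)) -> has_normal_form (\sum_(i <- r) f i).
Proof.
move=> FP; elim/big_rec: _ => [|i p _ pP]; first exact: nf_ideal.
exact: nfD.
Qed.

Lemma nf_Y j : has_normal_form (Y ^+ j).
Proof.
case: (ltnP j 4) => [lt_j|le_j].
  exists (delta_mx 0 (lshift 4 (Ordinal lt_j))).
  by rewrite monomial_comb_delta_l subrr; exact: I0.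
apply: nf_ideal; rewrite -(subnKC le_j) exprD -[_ ^+ 4]mul1r.
exact: IM.
Qed.

Lemma nf_XY j : has_normal_form (X * Y ^+ j).
Proof.
case: (ltnP j 4) => [lt_j|le_j].
  exists (delta_mx 0 (rshift 4 (Ordinal lt_j))).
  by rewrite monomial_comb_delta_r subrr; exact: I0.
apply: nf_ideal; rewrite -(subnKC le_j) exprD mulrA.
exact: IM.
Qed.

Lemma nf_XXY j : has_normal_form (X * (X * Y ^+ j)).
Proof.
apply: (nf_eq_mod (q := 2 *: Y ^+ (2 + j))); last exact/nfZ/nf_Y.
have -> : X * (X * Y ^+ j) - 2 *: Y ^+ (2 + j) = 1 * (X ^+ 2 - 2 *: Y ^+ 2) * Y ^+ j.
  by rewrite mul1r mulrBl -scalerAl exprD expr2 mulrA.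
exact: IM.
Qed.

Lemma nf_YXY j : has_normal_form (Y * (X * Y ^+ j)).
Proof.
apply: (nf_eq_mod (q := (-1) *: (X * Y ^+ j.+1))); last exact/nfZ/nf_XY.
have -> : Y * (X * Y ^+ j) - (-1) *: (X * Y ^+ j.+1) = 1 * (X * Y + Y * X) * Y ^+ j.
  by rewrite mul1r mulrDl scaleN1r opprK exprS !mulrA addrC.
exact: IM.
Qed.

Lemma nf_mul_gen g p : g = X \/ g = Y ->
  has_normal_form p -> has_normal_form (g * p).
Proof.
move=> XY_g [w pw]; apply: (nf_eq_mod (q := g * monomial_comb X Y w)).
  by rewrite -mulrBr -[_ * _]mulr1; exact: IM.
rewrite mulr_sumr; apply: nf_sum => j.
rewrite mulrDr !mulrZ.
case: XY_g => ->; apply: nfZD.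
- exact: nf_XY.
- exact/nfZ/nf_XXY.
- by rewrite -exprS; apply: nf_Y.
- exact/nfZ/nf_YXY.
Qed.

Lemma nf_1 : has_normal_form 1.
Proof. by rewrite -(expr0 Y); apply: nf_Y. Qed.

End NormalForms.

Lemma exists_normal_form (k : fieldType) (p : freeAlg k 2) :
  has_normal_form (fgen k 0) (fgen k 1) (in_ideal (nichols_rels k)) p.
Proof.
have mulrZ := @malg_scalerAr k {fmonom 'I_2}.
have I0 := in_ideal0 (nichols_rels k); have ID := @in_idealD _ _ (nichols_rels k).
have IZ := @in_idealZ _ _ (nichols_rels k); have IM := @in_idealM _ _ (nichols_rels k).
have rel n (lt_n : (n < 3)%N) := in_ideal_rel (mem_nth 0 (lt_n : n < size (nichols_rels k))%N).
have I_XX := rel 0%N isT; have I_XY := rel 1%N isT; have I_Y4 := rel 2%N isT.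
elim/freeAlg_ind: p => [||e p q pP qP|i p pP].
- exact: nf_ideal I0.
- exact: nf_1 I0 IM I_Y4.
- exact: nfZD ID IZ _ _ _ pP qP.
- apply: (nf_mul_gen mulrZ I0 ID IZ IM I_XX I_XY I_Y4) pP.
  by case: i => [[|[|//]] lt_i]; [left|right]; congr fgen; apply: val_inj.
Qed.

Section Presentation.
Variables (k : fieldType) (A : algType k) (x y : A).
Hypotheses (xxE : x * x = (y * y) *+ 2) (yxE : y * x = - (x * y)).
Hypotheses (y4 : y ^+ 4 = 0) (xy3_neq0 : x * y ^+ 3 != 0).
Hypothesis A_gen : forall S : {pred A}, GRing.subalg_closed S ->
  x \in S -> y \in S -> forall r, r \in S.

Let gens : 'I_2 -> A := fun i => [:: x; y]`_i.

Let free_eval_rels : {in nichols_rels k, forall r, free_eval gens r = 0}.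
Proof.
move=> r /(nthP 0)[[|[|[|//]]] _ <-] /=.
- transitivity (x ^+ 2 - 2 *: y ^+ 2); last by rewrite !expr2 xxE scaler_nat subrr.
  rewrite free_evalD free_evalN free_evalZ.
  exact: (congr2 (fun s t : A => s - 2 *: t) (free_eval_gen_exp gens 0 2)
                                             (free_eval_gen_exp gens 1 2)).
- transitivity (x * y + y * x); last by rewrite yxE subrr.
  rewrite free_evalD.
  exact: (congr2 +%R (free_eval_gen_mul gens 0 1) (free_eval_gen_mul gens 1 0)).
- exact: (etrans (free_eval_gen_exp gens 1 4) y4).
Qed.

Let free_eval_comb w :
  free_eval gens (monomial_comb (fgen k 0) (fgen k 1) w) = monomial_comb x y w.
Proof.
rewrite (linearmap_sum (linear_free_eval gens)); apply: eq_bigr => j _.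
rewrite free_evalD; congr (_ + _); rewrite free_evalZ; congr (_ *: _).
  exact: free_eval_gen_exp.
by rewrite free_evalM; congr (_ * _); [apply: free_eval_gen | apply: free_eval_gen_exp].
Qed.

Let y_ge4 n : (4 <= n)%N -> y ^+ n = 0.
Proof. by move=> le_n; rewrite -(subnK le_n) exprD y4 mulr0. Qed.

(* x kills x y^3, since x^2 y^3 = 2 y^5 = 0; hence multiplying by x isolates the
   coefficient of y^3 *)
Let top_indep e e' : e *: y ^+ 3 + e' *: (x * y ^+ 3) = 0 -> e = 0 /\ e' = 0.
Proof.
move=> h; have e0 : e = 0.
  have := congr1 ( *%R x) h.
  rewrite mulrDr mulr0 -!scalerAr [x * (x * _)]mulrA xxE mulrnAl -mulrA -!exprS.
  rewrite (@y_ge4 5) // mul0rn scaler0 addr0 => /eqP.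
  by rewrite scaler_eq0 (negPf xy3_neq0) orbF => /eqP.
split=> //; move/eqP: h; rewrite e0 scale0r add0r.
by rewrite scaler_eq0 (negPf xy3_neq0) orbF => /eqP.
Qed.

(* Right multiplication by y^(3 - m) kills the monomials of y-degree above m and
   sends those of y-degree m to y^3 and x y^3; those of y-degree below m have
   zero coefficients by induction. *)
Let comb_eq0 w : monomial_comb x y w = 0 -> w = 0.
Proof.
move=> w0.
have w_j m (lt_m : (m < 4)%N) :
    w 0 (lshift 4 (Ordinal lt_m)) = 0 /\ w 0 (rshift 4 (Ordinal lt_m)) = 0.
  elim/ltn_ind: m lt_m => m IH lt_m; apply: top_indep.
  have := congr1 ( *%R^~ (y ^+ (3 - m))) w0; rewrite mul0r mulr_suml.
  rewrite (bigD1 (Ordinal lt_m)) //= big1 => [|i ij].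
    by rewrite addr0 mulrDl -!scalerAl -mulrA -exprD subnKC.
  rewrite mulrDl -!scalerAl -mulrA -exprD.
  case: (ltngtP i m) => [lt_im|lt_mi|eq_im].
  - by have [] := IH i lt_im (ltn_ord i); rewrite (_ : Ordinal _ = i);
      [move=> -> ->; rewrite !scale0r addr0 | exact: val_inj].
  - by rewrite y_ge4 ?mulr0 ?scaler0 ?addr0 // addnBA // ltn_subRL ltn_add2r.
  - by case/eqP: ij; apply: val_inj.
apply/rowP => i; rewrite mxE.
by case: (split_ordP i) => j ->; have [] := w_j j (ltn_ord j);
  rewrite (_ : Ordinal _ = j) //; apply: val_inj.
Qed.

Let eval_comb p : exists2 w, in_ideal (nichols_rels k)
    (p - monomial_comb (fgen k 0) (fgen k 1) w) &
  free_eval gens p = monomial_comb x y w.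
Proof.
have [w pw] := exists_normal_form p; exists w => //.
rewrite -free_eval_comb; apply/eqP.
rewrite -subr_eq0 -free_evalN -free_evalD; apply/eqP.
exact: free_eval_ideal free_eval_rels pw.
Qed.

(** A polynomial and its normal form have the same value. When that value is zero
    the normal form is zero by independence, which leaves an element of the
    ideal. *)
Lemma presents_nichols : presents gens (nichols_rels k).
Proof.
split=> [r|p]; last split; last exact: free_eval_ideal free_eval_rels.
- pose S : {pred A} := fun r => `[< exists p, free_eval gens p = r >].
  suff /asboolP : r \in S by [].
  apply: A_gen; first split.
  + by apply/asboolP; exists 1; rewrite free_eval1.
  + move=> e u v /asboolP[p <-] /asboolP[q <-]; apply/asboolP.
    by exists (e *: p + q); rewrite free_evalD free_evalZ.
  + move=> u v /asboolP[p <-] /asboolP[q <-]; apply/asboolP.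
    by exists (p * q); rewrite free_evalM.
  + by apply/asboolP; exists (fgen k 0); rewrite free_eval_gen.
  + by apply/asboolP; exists (fgen k 1); rewrite free_eval_gen.
- have [w pw ->] := eval_comb p => /comb_eq0 w0.
  by move: pw; rewrite w0 (linearmap0 (linear_monomial_comb _ _)) subr0.
Qed.

Lemma has_dim8 : has_dim A 8.
Proof.
have surj r : exists w, monomial_comb x y w = r.
  by have [p <-] := presents_nichols.1 r; have [w _ ->] := eval_comb p; exists w.
have [f fK] := choice surj.
have comb_inj : injective (monomial_comb x y).
  move=> w w' /eqP; rewrite -subr_eq0 -scaleN1r => /eqP eq_w.
  apply/eqP; rewrite -subr_eq0 -scaleN1r addrC; apply/eqP/comb_eq0.
  by rewrite linear_monomial_comb addrC.
exists f => [e u v|]; first by apply: comb_inj; rewrite linear_monomial_comb !fK.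
by exists (monomial_comb x y) => [//|w]; apply: comb_inj; rewrite fK.
Qed.

End Presentation.

(** * The Nichols algebra *)

Section NicholsV31.
Variables (k : fieldType) (xi : k).
Hypotheses (two_neq0 : 2 != 0 :> k) (xi2 : xi ^+ 2 = -1).
Variables (K : hopfAlg k) (a b c d : K) (K_def : isK xi a b c d).
Variables (V : ydModule K) (e1 e2 : V) (V_def : isVi1 xi a b c d 3 e1 e2).
Variables (R : braidedHopfData K) (iota : V -> R) (R_nichols : isNichols iota).

Let R_hopf := nichols_hopf R_nichols.
Let x : R := iota e1.
Let y : R := iota e2.
Let kap : k := (1 + xi) / 2.

Lemma xi3 : xi ^+ 3 = - xi.
Proof. by rewrite exprSr xi2 mulN1r. Qed.

Lemma xi_mul : xi * xi = -1.
Proof. by rewrite -expr2. Qed.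

Lemma xi3V : (xi ^+ 3)^-1 = xi.
Proof.
have xi_neq0 : xi != 0.
  apply/eqP => xi0; have := xi_mul.
  by rewrite xi0 mul0r => /eqP; rewrite eq_sym oppr_eq0 oner_eq0.
by rewrite xi3 invrN -[RHS](mulKf xi_neq0) xi_mul mulrN1.
Qed.

Lemma act_iota h v : h ▷ iota v = iota (act h v).
Proof. by rewrite (ydhom_act (nichols_hom R_nichols)). Qed.

Lemma linear_iota : linear iota.
Proof. exact: ydhom_linear (nichols_hom R_nichols). Qed.

Lemma act_ax : a ▷ x = - xi *: x.
Proof. by rewrite act_iota (V_a1 V_def) (linearmapZ linear_iota) xi3. Qed.
Lemma act_bx : b ▷ x = 0.
Proof. by rewrite act_iota (V_b1 V_def) (linearmap0 linear_iota). Qed.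
Lemma act_cx : c ▷ x = 0.
Proof. by rewrite act_iota (V_c1 V_def) (linearmap0 linear_iota). Qed.
Lemma act_dx : d ▷ x = xi *: x.
Proof. by rewrite act_iota (V_d1 V_def) (linearmapZ linear_iota) xi3V. Qed.
Lemma act_ay : a ▷ y = - y.
Proof.
rewrite act_iota (V_a2 V_def) (linearmapZ linear_iota) xi3 mulrN xi_mul opprK.
by rewrite scaleN1r.
Qed.
Lemma act_by : b ▷ y = - x.
Proof.
rewrite act_iota (V_b2 V_def) (linearmapZ linear_iota) xi3 sqrrN xi2.
by rewrite scaleN1r.
Qed.
Lemma act_cy : c ▷ y = x.
Proof. by rewrite act_iota (V_c2 V_def). Qed.
Lemma act_dy : d ▷ y = - y.
Proof.
rewrite act_iota (V_d2 V_def) (linearmapZ linear_iota) xi3V xi_mul.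
by rewrite scaleN1r.
Qed.

Lemma coact_iota v :
  bh_coact (iota v) = \tsum_(h, v0 <- coact v) h ⊠ iota v0.
Proof. by rewrite -(ydhom_coact (nichols_hom R_nichols)). Qed.

Let iota_bil : bilinear_map (fun (h : K) v => h ⊠ iota v).
Proof.
split=> [h|v] e u u'; last by rewrite linear_tpurel.
by rewrite linear_iota linear_tpurer.
Qed.

Lemma coact_x : bh_coact x = d ⊠ x + ((xi - 1) *: c) ⊠ y.
Proof.
have coefE : (xi ^+ 3) ^+ 3 - xi * xi ^+ 3 = xi - 1.
  rewrite xi3 mulrN opprK xi_mul; have -> : (- xi) ^+ 3 = - xi ^+ 3 by ring.
  by rewrite xi3 opprK.
rewrite coact_iota (V_coact1 V_def) linearmapD; last exact: tlift_linear.
by rewrite (tlift_pure iota_bil) (tlift_pure iota_bil) coefE.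
Qed.

Lemma coact_y : bh_coact y = a ⊠ y + (- kap *: b) ⊠ x.
Proof.
have coefE : 2^-1 * (xi ^+ 3 + xi * (xi ^+ 3) ^+ 3) = - kap.
  rewrite xi3; have -> : (- xi) ^+ 3 = - xi ^+ 3 by ring.
  by rewrite xi3 opprK xi_mul /kap -opprD mulrN mulrC addrC.
rewrite coact_iota (V_coact2 V_def) linearmapD; last exact: tlift_linear.
by rewrite (tlift_pure iota_bil) (tlift_pure iota_bil) coefE.
Qed.

Lemma actZ g h (u : R) : (g *: h : K) ▷ u = g *: (h ▷ u).
Proof. exact: (linearmapZ (linear_actl R_hopf u)). Qed.

Lemma primitive_iota v : primitive (iota v).
Proof. by apply/(nichols_prim R_nichols)/(nichols1 R_nichols); exists v. Qed.

Lemma mulx_pure r s : primitive_mul x (r ⊠ s) =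
  (x * r) ⊠ s + (d ▷ r) ⊠ (x * s) + (xi - 1) *: (c ▷ r) ⊠ (y * s).
Proof. by rewrite (primitive_mul_pure R_hopf _ _ coact_x) actZ tpureZl addrA. Qed.

Lemma muly_pure r s : primitive_mul y (r ⊠ s) =
  (y * r) ⊠ s + (a ▷ r) ⊠ (y * s) - kap *: (b ▷ r) ⊠ (x * s).
Proof.
by rewrite (primitive_mul_pure R_hopf _ _ coact_y) actZ tpureZl scaleNr addrA.
Qed.

Lemma comul_xM r : bcomul (x * r) = primitive_mul x (bcomul r).
Proof. exact/comul_mul_primitive/primitive_iota. Qed.

Lemma comul_yM r : bcomul (y * r) = primitive_mul y (bcomul r).
Proof. exact/comul_mul_primitive/primitive_iota. Qed.

Lemma act_aM (u v : R) : a ▷ (u * v) = (a ▷ u) * (a ▷ v) + (b ▷ u) * (c ▷ v).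
Proof. exact/act_mul2/(K_comul_a K_def). Qed.
Lemma act_bM (u v : R) : b ▷ (u * v) = (a ▷ u) * (b ▷ v) + (b ▷ u) * (d ▷ v).
Proof. exact/act_mul2/(K_comul_b K_def). Qed.
Lemma act_cM (u v : R) : c ▷ (u * v) = (c ▷ u) * (a ▷ v) + (d ▷ u) * (c ▷ v).
Proof. exact/act_mul2/(K_comul_c K_def). Qed.
Lemma act_dM (u v : R) : d ▷ (u * v) = (c ▷ u) * (b ▷ v) + (d ▷ u) * (d ▷ v).
Proof. exact/act_mul2/(K_comul_d K_def). Qed.

Lemma act_a1 : a ▷ (1 : R) = 1.
Proof. by rewrite (act_one R_hopf) (K_counit_a K_def) scale1r. Qed.
Lemma act_b1 : b ▷ (1 : R) = 0.
Proof. by rewrite (act_one R_hopf) (K_counit_b K_def) scale0r. Qed.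
Lemma act_c1 : c ▷ (1 : R) = 0.
Proof. by rewrite (act_one R_hopf) (K_counit_c K_def) scale0r. Qed.
Lemma act_d1 : d ▷ (1 : R) = 1.
Proof. by rewrite (act_one R_hopf) (K_counit_d K_def) scale1r. Qed.

Lemma iota_grade v : iota v \in grade 1.
Proof. by apply/(nichols1 R_nichols); exists v. Qed.

Lemma iota_basis v : exists e e', iota v = e *: x + e' *: y.
Proof.
have [[e e'] [-> _]] := V_basis V_def v; exists e, e'.
by rewrite linear_iota (linearmapZ linear_iota).
Qed.

Lemma iota_indep e e' g g' : e *: x + e' *: y = g *: x + g' *: y -> e = g /\ e' = g'.
Proof.
rewrite -!(linearmapZ linear_iota) -!(linearmapD linear_iota).
move=> /(nichols_inj R_nichols) eq_v.
have [u [_ u_uniq]] := V_basis V_def (e *: e1 + e' *: e2).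
by have := u_uniq (e, e') erefl; rewrite (u_uniq (g, g') eq_v) => -[-> ->].
Qed.

(** Primitive elements have degree one, and distinct degrees meet in zero. *)
Lemma primitive_homogeneous_eq0 n (r : R) :
  r \in grade n -> n <> 1%N -> primitive r -> r = 0.
Proof.
move=> r_n n1 /(nichols_prim R_nichols) r_1.
have [p _ [_ p_id p_0]] := exists_component (bh_grading R_hopf) 1.
by rewrite -(p_id _ r_1); apply: p_0 n1 r_n.
Qed.

(** The coefficient of x in the component of degree one. *)
Lemma exists_first_coordinate : exists f : R -> k,
  [/\ linear (f : R -> k^o), f x = 1, f y = 0 &
      forall n u, u \in grade n -> n <> 1%N -> f u = 0].
Proof.
have [p p_lin [p_1 p_id p_0]] := exists_component (bh_grading R_hopf) 1.
have coordP r : exists e : k, exists e', p r = e *: x + e' *: y.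
  by have /(nichols1 R_nichols)[v ->] := p_1 r; apply: iota_basis.
have [f f_coord] := choice coordP.
have f_uniq r e e' : p r = e *: x + e' *: y -> f r = e.
  by have [g ->] := f_coord r => /iota_indep[].
exists f; split=> [e r s|||n u u_n n1].
- have [[g rE] [h sE]] := (f_coord r, f_coord s).
  apply: (f_uniq _ _ (e * g + h)).
  by rewrite p_lin rE sE !scalerDl scalerDr !scalerA addrACA.
- by apply: (f_uniq _ _ 0); rewrite p_id ?iota_grade // scale1r scale0r addr0.
- by apply: (f_uniq _ _ 1); rewrite p_id ?iota_grade // scale1r scale0r add0r.
- by apply: (f_uniq _ _ 0); rewrite (p_0 _ _ n1 u_n) !scale0r addr0.
Qed.

(** The identities that enter the coproduct computation hold in R, with R ⊗ R as
    target and with id ⊗ f as contraction. *)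
Lemma relations_V31 : [/\ x * x = (y * y) *+ 2, y * x = - (x * y),
  y ^+ 4 = 0 & x * y ^+ 3 != 0].
Proof.
have [f [f_lin fx fy f_deg]] := exists_first_coordinate.
have f1 : f 1 = 0 by apply: (f_deg 0%N) => //; apply: grade1.
have ev_bil : bilinear_map (fun r s : R => f s *: r).
  split=> [r|s] e u u'; last by rewrite scalerDr !scalerA mulrC.
  by rewrite f_lin scalerDl scalerA.
have y_neq0 : y != 0.
  apply/eqP => y0; have := @iota_indep 0 1 0 0.
  rewrite y0 !scaler0 => /(_ erefl) [_ /eqP].
  by rewrite oner_eq0.
have a_gens : [/\ a ▷ (1 : R) = 1, a ▷ x = - xi *: x & a ▷ y = - y].
  by split; [apply: act_a1|apply: act_ax|apply: act_ay].
have b_gens : [/\ b ▷ (1 : R) = 0, b ▷ x = 0 & b ▷ y = - x].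
  by split; [apply: act_b1|apply: act_bx|apply: act_by].
have c_gens : [/\ c ▷ (1 : R) = 0, c ▷ x = 0 & c ▷ y = x].
  by split; [apply: act_c1|apply: act_cx|apply: act_cy].
have d_gens : [/\ d ▷ (1 : R) = 1, d ▷ x = xi *: x & d ▷ y = - y].
  by split; [apply: act_d1|apply: act_dx|apply: act_dy].
apply: (relations_from_coproduct two_neq0 xi2 (@tpure_bilinear k R R)
  a_gens b_gens c_gens d_gens act_aM act_bM act_cM act_dM
  (comul_linear (bh_coalgebra R_hopf))
  (linear_primitive_mul R_hopf x) (linear_primitive_mul R_hopf y)
  (primitive_iota e1) (primitive_iota e2) comul_xM comul_yM mulx_pure muly_pure
  (deg := @grade k K R) _ (gradeM R_hopf) (iota_grade e1) (iota_grade e2)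
  primitive_homogeneous_eq0 (tlift_linear ev_bil) (tlift_pure ev_bil)
  f1 fx fy f_deg y_neq0) => n e u v.
exact: (gradedZD (bh_grading R_hopf)).
Qed.

Lemma generated_by_xy (S : {pred R}) : GRing.subalg_closed S ->
  x \in S -> y \in S -> forall r, r \in S.
Proof.
move=> S_alg xS yS; apply: (nichols_gen R_nichols) => // u /(nichols1 R_nichols)[v ->].
have [_ S_lin _] := S_alg; have [e [e' ->]] := iota_basis v.
have S0 : 0 \in S by rewrite -(addNr x) -scaleN1r; apply: S_lin.
by apply: (S_lin) => //; rewrite -[e' *: y]addr0; apply: S_lin.
Qed.

End NicholsV31.

Theorem proposition4p10 (k : closedFieldType) (char0 : [pchar k] =i pred0)
    (xi : k) (xi_prim : 4.-primitive_root xi)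
    (K : hopfAlg k) (a b c d : K) (K_def : isK xi a b c d)
    (V : ydModule K) (e1 e2 : V) (V_def : isVi1 xi a b c d 3 e1 e2)
    (R : braidedHopfData K) (iota : V -> R) (R_nichols : isNichols iota) :
  presents (fun i : 'I_2 => [:: iota e1; iota e2]`_i) (nichols_rels k) /\
  has_dim R 8.
Proof.
have two_neq0 : 2 != 0 :> k by rewrite (pcharf0P k).1.
have xi2 : xi ^+ 2 = -1.
  have : (xi ^+ 2) ^+ 2 == 1 by rewrite -exprM (prim_expr_order xi_prim).
  by rewrite sqrf_eq1 -(prim_order_dvd xi_prim) /= => /eqP.
have [xx yx y4 xy3] := relations_V31 two_neq0 xi2 K_def V_def R_nichols.
have gen := generated_by_xy V_def R_nichols.
by split; [apply: presents_nichols xx yx y4 xy3 gen | apply: has_dim8 xx yx y4 xy3 gen].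
Qed.
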